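(* Define integers $a_{\mathcal{G}}(n)$, $n\ge0$, by $a_{\mathcal{G}}(0)=1$, $a_{\mathcal{G}}(1)=-1$, $a_{\mathcal{G}}(2)=-1$ and, for $n\ge3$, $$a_{\mathcal{G}}(n)=-\frac12\left(\sum_{k=0}^{n-2}a_{\mathcal{G}}(k)\binom{n-1}{k}2^{n-1-k}+\sum_{k=0}^{n-1}a_{\mathcal{G}}(k)\binom{n}{k}2^{n-k}\right).$$ Then for all $n\ge1$, $$\sum_{k=0}^{2n-1}a_{\mathcal{G}}(k)\binom{2n}{k}2^{2n-k}=0.$$ *)

(* Defs.v *)
From HB Require Import structures.
From mathcomp Require Import all_boot all_order all_algebra.
Set Implicit Arguments.
Unset Strict Implicit.
Unset Printing Implicit Defensive.
Import GRing.Theory.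
Local Open Scope ring_scope.

Definition aG_sum (a : nat -> int) (n : nat) : int :=
  \sum_(0 <= k < n.-1) a k * 'C(n.-1, k)%:Z * 2 ^+ (n.-1 - k)
  + \sum_(0 <= k < n) a k * 'C(n, k)%:Z * 2 ^+ (n - k).

(* The Euclidean division by 2 is exact, every term of aG_sum being even:
   see aG_rec below for the recurrence with the rational factor -1/2. *)
Definition aG_step (a : nat -> int) (n : nat) : int :=
  match n with
  | 0%N => 1
  | 1%N => -1
  | 2%N => -1
  | _ => - (aG_sum a n %/ 2)%Z
  end.

(* Course-of-values recursion: aG_table n = [:: a(0); ...; a(n-1)]. *)
Fixpoint aG_table (n : nat) : seq int :=
  if n is m.+1
  then rcons (aG_table m) (aG_step (nth 0 (aG_table m)) m)
  else [::].

Definition aG (n : nat) : int := nth 0 (aG_table n.+1) n.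

Lemma size_aG_table n : size (aG_table n) = n.
Proof. by elim: n => //= n IHn; rewrite size_rcons IHn. Qed.

Lemma nth_aG_table n k : (k < n)%N -> nth 0 (aG_table n) k = aG k.
Proof.
elim: n => // n IHn; rewrite ltnS leq_eqVlt => /predU1P[-> // | lt_kn].
by rewrite /= nth_rcons size_aG_table lt_kn IHn.
Qed.

Lemma eq_aG_sum a b n :
  (forall k, (k < n)%N -> a k = b k) -> aG_sum a n = aG_sum b n.
Proof.
move=> eq_ab; rewrite /aG_sum; congr (_ + _); apply: eq_big_nat => k /= lt_kn;
  rewrite eq_ab //.
exact: leq_trans lt_kn (leq_pred n).
Qed.

Lemma aG_sum_even a n : (2 %| aG_sum a n)%Z.
Proof.
have even_term m k (x : int) : (k < m)%N -> (2 %| x * 2 ^+ (m - k))%Z.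
  by move=> lt_km; rewrite -(subnSK lt_km) exprS mulrCA dvdz_mulr.
by rewrite /aG_sum !big_nat; apply: rpredD; apply: rpred_sum => k /= lt_k;
  apply: even_term.
Qed.

Lemma aG0 : aG 0 = 1. Proof. by []. Qed.
Lemma aG1 : aG 1 = -1. Proof. by []. Qed.
Lemma aG2 : aG 2 = -1. Proof. by []. Qed.

Lemma aG_rec n : (3 <= n)%N ->
  (aG n)%:~R = - (1 / 2)
    * (\sum_(0 <= k < n.-1) (aG k)%:~R * 'C(n.-1, k)%:R * 2 ^+ (n.-1 - k)
       + \sum_(0 <= k < n) (aG k)%:~R * 'C(n, k)%:R * 2 ^+ (n - k)) :> rat.
Proof.
move=> n_ge3.
have aGE : aG n = - (aG_sum aG n %/ 2)%Z.
  rewrite /aG /= nth_rcons size_aG_table ltnn eqxx.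
  have -> : aG_step (nth 0 (aG_table n)) n
            = - (aG_sum (nth 0 (aG_table n)) n %/ 2)%Z.
    by case: n n_ge3 => [|[|[|n]]].
  by rewrite (eq_aG_sum (b := aG)) // => k; apply: nth_aG_table.
have sumE m : \sum_(0 <= k < m) (aG k)%:~R * 'C(m, k)%:R * 2 ^+ (m - k)
    = (\sum_(0 <= k < m) aG k * 'C(m, k)%:Z * 2 ^+ (m - k))%:~R :> rat.
  by rewrite rmorph_sum; apply: eq_bigr => k _; rewrite !rmorphM rmorphXn.
rewrite !sumE -intrD -/(aG_sum aG n) -{1}(divzK (aG_sum_even aG n)) aGE.
by rewrite rmorphN rmorphM /= mulNr div1r mulrCA mulVf ?mulr1.
Qed.

(* Main.v *)
Require Import Defs.
From mathcomp Require Import all_boot all_order all_algebra.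
From mathcomp Require Import zify ring.
Set Implicit Arguments.
Unset Strict Implicit.
Unset Printing Implicit Defensive.
Import GRing.Theory.
Local Open Scope ring_scope.

(** Let [b] be the binomial transform of [a] with parameter 2, so that
    [b n = T n + a n], where [T n] is the sum of the theorem.  The recurrence
    reads [2 a(n) + T(n-1) + T(n) = 0] for [n >= 1].  We show
    [b n = (-1)^n a n] by strong induction.  If [n] is odd, then [T (n-1) = 0]
    and the recurrence says [b n = - a n].  If [n] is even, then inverting the
    binomial transform and using the induction hypothesis for the indices below
    [n] gives [a n = b n + T n = a n + 2 T n]. *)

Lemma coef_addCX_exp (R : comNzRingType) (c : R) n i :
  ((c%:P + 'X) ^+ n)`_i = c ^+ (n - i) *+ 'C(n, i).
Proof.
rewrite exprDn coef_sum.
under eq_bigr => j _ do rewrite coefMn -polyC_exp coefCM coefXn.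
have [le_in | lt_ni] := leqP i n.
  rewrite (bigD1 (Ordinal (le_in : (i < n.+1)%N))) //= eqxx mulr1 big1 ?addr0 //.
  move=> j /eqP ne_ji; case: eqP => [eq_ij|]; last by rewrite mulr0 mul0rn.
  by case: ne_ji; apply: val_inj.
rewrite bin_small // mulr0n big1 // => j _.
by rewrite gtn_eqF ?mulr0 ?mul0rn //; apply: leq_ltn_trans lt_ni; rewrite -ltnS.
Qed.

Definition binom_transform (R : comNzRingType) (c : R) (a : nat -> R) n : R :=
  \sum_(k < n.+1) a k * 'C(n, k)%:R * c ^+ (n - k).

(** Terms with [k > n] vanish with ['C(n, k)]; a common range for all inner sums lets the double sum
    of the inversion be exchanged. *)
Lemma binom_transform_widen (R : comNzRingType) (c : R) (a : nat -> R) n m :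
  (n < m)%N ->
  binom_transform c a n = \sum_(k < m) a k * 'C(n, k)%:R * c ^+ (n - k).
Proof.
move=> lt_nm; rewrite /binom_transform.
rewrite (big_ord_widen m (fun k => a k * 'C(n, k)%:R * c ^+ (n - k))) //.
rewrite big_mkcond; apply: eq_bigr => k _; rewrite ltnS.
by case: leqP => // lt_nk; rewrite bin_small // mulr0 mul0r.
Qed.

(* Coefficientwise form of ['X^n = (- c + (c + 'X)) ^+ n]. *)
Lemma binom_transformK (R : comNzRingType) (c : R) (a : nat -> R) n :
  binom_transform (- c) (binom_transform c a) n = a n.
Proof.
have XnE : 'X^n = \sum_(k < n.+1) ((- c) ^+ (n - k) *+ 'C(n, k))
                                   *: (c%:P + 'X) ^+ k.
  rewrite -{1}[X in X ^+ n](addKr c%:P) -polyCN exprDn.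
  by apply: eq_bigr => k _; rewrite -polyC_exp mul_polyC scalerMnl.
rewrite {1}/binom_transform.
under eq_bigr => k _
  do rewrite (@binom_transform_widen _ _ _ k n.+1) // -mulrA mulr_suml.
rewrite exchange_big /=.
transitivity (\sum_(j < n.+1) a j * ('X^n)`_j).
  apply: eq_bigr => j _; rewrite XnE coef_sum mulr_sumr; apply: eq_bigr => k _.
  rewrite coefZ coef_addCX_exp -[_ *+ 'C(n, k)]mulr_natr -[_ *+ 'C(k, j)]mulr_natr.
  by ring.
rewrite big_ord_recr /= coefXn eqxx mulr1 big1 ?add0r // => j _.
by rewrite coefXn ltn_eqF ?mulr0.
Qed.

Definition aG_partial (m : nat) : int :=
  \sum_(0 <= k < m) aG k * 'C(m, k)%:Z * 2 ^+ (m - k).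

Lemma binom_transform_aG n : binom_transform 2 aG n = aG_partial n + aG n.
Proof.
rewrite /binom_transform big_ord_recr /= binn subnn !mulr1.
rewrite /aG_partial big_mkord; congr (_ + _).
by apply: eq_bigr => k _; rewrite (natz 'C(n, k)).
Qed.

(** Indices 1 and 2 lie outside [aG_rec], but the initial values satisfy the same relation, so it is
    available at every odd index. *)
Lemma aG_partial_rec n : 2 * aG n.+1 + aG_partial n + aG_partial n.+1 = 0.
Proof.
case: n => [|[|n]].
- by rewrite /aG_partial big_nat1 big_geq.
- by rewrite /aG_partial big_nat1 unlock.
apply: (@intr_inj rat); have := @aG_rec n.+3 isT.
have castE m : \sum_(0 <= k < m) (aG k)%:~R * 'C(m, k)%:R * 2 ^+ (m - k)
    = (aG_partial m)%:~R :> rat.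
  rewrite rmorph_sum; apply: eq_bigr => k _.
  by rewrite !rmorphM rmorphXn.
by rewrite !castE !rmorphD rmorphM /= => ->; field.
Qed.

Lemma binom_transform_aG_sign n : binom_transform 2 aG n = (-1) ^+ n * aG n.
Proof.
elim/ltn_ind: n => n IHn; rewrite binom_transform_aG -signr_odd.
have [odd_n | even_n] := boolP (odd n); rewrite /= ?expr0 ?expr1.
  case: n odd_n IHn => // n even_n IHn.
  (* At the even predecessor the hypothesis reads [aG_partial n + aG n = aG n], so
     [aG_partial n = 0]. *)
  have := IHn n (ltnSn n); have := aG_partial_rec n.
  by rewrite binom_transform_aG -signr_odd (negbTE (even_n : ~~ odd n)) expr0; lia.
have := binom_transformK 2 aG n.
rewrite {1}/binom_transform big_ord_recr /= binn subnn !mulr1 binom_transform_aG.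
(* With the top term [aG_partial n + aG n] split off, inversion then becomes
   [2 * aG_partial n = 0]. *)
suff -> : \sum_(k < n) binom_transform 2 aG k * 'C(n, k)%:R * (- 2) ^+ (n - k)
          = aG_partial n by lia.
rewrite /aG_partial big_mkord; apply: eq_bigr => k _.
(* As [n] is even, the sign of [(- 2) ^+ (n - k)] cancels the one supplied by the induction
   hypothesis at [k]. *)
have sign_nk : (-1) ^+ (n - k) = (-1) ^+ k :> int.
  rewrite -signr_odd oddB ?(ltnW (ltn_ord k)) // (negbTE even_n) /=.
  by rewrite signr_odd.
rewrite IHn // -(mulN1r 2) exprMn sign_nk (natz 'C(n, k)).
by rewrite -[RHS]mul1r -[X in _ = X * _](sqrr_sign int k); ring.
Qed.

Theorem mainTheorem18 (n : nat) (hn : (1 <= n)%N) :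
  \sum_(0 <= k < 2 * n) aG k * 'C(2 * n, k)%:Z * 2 ^+ (2 * n - k) = 0.
Proof.
have := binom_transform_aG_sign (2 * n).
rewrite binom_transform_aG -signr_odd oddM expr0 mul1r.
by rewrite -{2}[aG _]add0r => /addIr.
Qed.
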